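(* For any set $\Lambda\subseteq\mathcal{S}_3$ such that $\{123,321\}\subseteq\Lambda$, we have $c_n(\Lambda)=0$ for all $n\ge5$.
   Context: $\mathcal{S}_n$ is the set of permutations of $[n]=\{1,\dots,n\}$, written as words. A word $\pi=\pi_1\dots\pi_m$ over the positive integers contains the pattern $\sigma=\sigma_1\dots\sigma_k$ if there are indices $1\le i_1<\dots<i_k\le m$ such that for all $r,s\in[k]$: $\pi_{i_r}<\pi_{i_s}$ iff $\sigma_r<\sigma_s$, and $\pi_{i_r}=\pi_{i_s}$ iff $\sigma_r=\sigma_s$; otherwise $\pi$ avoids $\sigma$. $\mathcal{C}_n$ denotes the set of nonnesting permutations: arrangements (words) of the multiset $\{1,1,2,2,\dots,n,n\}$ that avoid the patterns $1221$ and $2112$. For a set $\Lambda$ of patterns, $\mathcal{C}_n(\Lambda)$ is the set of $\pi\in\mathcal{C}_n$ avoiding every pattern in $\Lambda$, and $c_n(\Lambda)=|\mathcal{C}_n(\Lambda)|$. *)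

(* Defs.v *)
From mathcomp Require Import all_boot finmap.

Set Implicit Arguments.
Unset Strict Implicit.
Unset Printing Implicit Defensive.

Local Open Scope fset_scope.

Definition word := seq nat.

(* [f] lists the (0-based) positions i_1 < ... < i_k of the occurrence. *)
Definition contains (w p : word) : bool :=
  [exists f : {ffun 'I_(size p) -> 'I_(size w)},
    [forall r : 'I_(size p), forall s : 'I_(size p), (r < s) ==> (f r < f s)] &&
    [forall r : 'I_(size p), forall s : 'I_(size p),
       ((nth 0 w (f r) < nth 0 w (f s)) == (nth 0 p r < nth 0 p s)) &&
       ((nth 0 w (f r) == nth 0 w (f s)) == (nth 0 p r == nth 0 p s))]].

Definition avoids (w p : word) : bool := ~~ contains w p.

Definition Sn (n : nat) : {fset word} := [fset w in permutations (iota 1 n)].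

Definition double_multiset (n : nat) : word :=
  flatten [seq [:: i; i] | i <- iota 1 n].

Definition nonnesting (n : nat) : {fset word} :=
  [fset w in permutations (double_multiset n) |
     avoids w [:: 1; 2; 2; 1] && avoids w [:: 2; 1; 1; 2]].

Definition nonnesting_av (n : nat) (L : {fset word}) : {fset word} :=
  [fset w in nonnesting n | all (avoids w) L].

Definition cn (n : nat) (L : {fset word}) : nat := #|` nonnesting_av n L|.

(* Main.v *)
Require Import Defs.
From mathcomp Require Import all_boot finmap.

(** The result is the first case of the Erdos-Szekeres theorem: among any five
    distinct numbers written in a row, some three form a monotone subsequence.  A
    word on [{1,1,...,n,n}] with [n >= 5] contains at least five distinct
    letters, hence a copy of [123] or of [321], so no such word avoids both.

    The proof of the five-term case is a direct one.  Let the terms be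
    [a, b, c, d, e] and suppose that [a < b].  A later term above [b] would
    extend [a < b] to an increasing triple, so [c, d, e] all lie below [b];
    then a descent inside [c, d, e] would extend downwards from [b], and the
    absence of such a descent makes [c < d < e].  The case [b < a] is the same
    with the order reversed. *)

Local Open Scope fset_scope.

(** An occurrence of a pattern is given by positions, but a subsequence with the
    right relative order is enough: the mask that extracts the subsequence from
    [w] also extracts its positions from [0, 1, ..., size w - 1]. *)
Lemma contains_subseq (w s p : word) :
  subseq s w -> size s = size p ->
  (forall i j, i < size p -> j < size p ->
     (nth 0 s i < nth 0 s j) = (nth 0 p i < nth 0 p j)
     /\ (nth 0 s i == nth 0 s j) = (nth 0 p i == nth 0 p j)) ->
  contains w p.
Proof.
case/subseqP=> m _ -> {s} sz_p iso_p.
pose pos := mask m (iota 0 (size w)).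
have pos_w : mask m w = map (nth 0 w) pos.
  by rewrite /pos map_mask -/(mkseq _ _) mkseq_nth.
have sz_pos : size pos = size p by rewrite -sz_p pos_w size_map.
have pos_sub : subseq pos (iota 0 (size w)) by apply: mask_subseq.
have pos_sorted : sorted ltn pos.
  exact: (subseq_sorted ltn_trans pos_sub (iota_ltn_sorted _ _)).
have pos_lt (i : 'I_(size p)) : nth 0 pos i < size w.
  have: nth 0 pos i \in iota 0 (size w).
    by apply: (mem_subseq pos_sub); rewrite mem_nth ?sz_pos.
  by rewrite mem_iota.
have nth_pos (i : 'I_(size p)) : nth 0 w (nth 0 pos i) = nth 0 (mask m w) i.
  by rewrite pos_w (nth_map 0) ?sz_pos.
apply/existsP; exists [ffun i => Ordinal (pos_lt i)].
apply/andP; split; apply/forallP=> i; apply/forallP=> j; rewrite !ffunE /=.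
  apply/implyP=> lt_ij.
  by apply: (sorted_ltn_nth ltn_trans); rewrite ?inE ?sz_pos.
by rewrite !nth_pos; case: (iso_p i j) => // -> ->; rewrite !eqxx.
Qed.

Lemma ltn_cmp (u v : nat) : u < v ->
  ((u < v) = true) * ((v < u) = false) * ((u == v) = false) * ((v == u) = false).
Proof. by move=> uv; rewrite uv (ltn_eqF uv) (gtn_eqF uv) ltnNge (ltnW uv). Qed.

Lemma contains_123 (w : word) (x y z : nat) :
  subseq [:: x; y; z] w -> x < y -> y < z -> contains w [:: 1; 2; 3].
Proof.
move=> sub_w xy yz; have xz := ltn_trans xy yz.
apply: (contains_subseq _ _ _ sub_w) => // -[|[|[|i]]] [|[|[|j]]] //= _ _;
  by rewrite ?ltnn ?eqxx ?(ltn_cmp _ _ xy) ?(ltn_cmp _ _ yz) ?(ltn_cmp _ _ xz).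
Qed.

Lemma contains_321 (w : word) (x y z : nat) :
  subseq [:: x; y; z] w -> y < x -> z < y -> contains w [:: 3; 2; 1].
Proof.
move=> sub_w yx zy; have zx := ltn_trans zy yx.
apply: (contains_subseq _ _ _ sub_w) => // -[|[|[|i]]] [|[|[|j]]] //= _ _;
  by rewrite ?ltnn ?eqxx ?(ltn_cmp _ _ yx) ?(ltn_cmp _ _ zy) ?(ltn_cmp _ _ zx).
Qed.

(** Stated for a relation [r] so that the same argument serves both [<] and
    [>], that is, both signs of the first step. *)
Lemma monotone_triple_of_step (T : eqType) (r : rel T) (a b c d e : T) :
  (forall x y, x != y -> r x y || r y x) ->
  uniq [:: a; b; c; d; e] -> r a b ->
  exists x y z, subseq [:: x; y; z] [:: a; b; c; d; e]
    /\ (r x y && r y z || r y x && r z y).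
Proof.
move=> r_total uniq_s r_ab.
have pick m x y z : mask m [:: a; b; c; d; e] = [:: x; y; z] -> size m = 5 ->
    r x y && r y z || r y x && r z y ->
    exists x y z, subseq [:: x; y; z] [:: a; b; c; d; e]
      /\ (r x y && r y z || r y x && r z y).
  by move=> mask_m sz_m mono; exists x, y, z; split=> //; apply/subseqP; exists m.
move: uniq_s; rewrite /= !inE !negb_or !andbT.
case/and4P=> _ /and3P[bc bd be] /andP[cd _] de.
case bc': (r b c).
  by apply: (pick [:: true; true; true; false; false] a b c); rewrite ?r_ab ?bc'.
case bd': (r b d).
  by apply: (pick [:: true; true; false; true; false] a b d); rewrite ?r_ab ?bd'.
case be': (r b e).
  by apply: (pick [:: true; true; false; false; true] a b e); rewrite ?r_ab ?be'.
move: (r_total _ _ bc) (r_total _ _ bd); rewrite bc' bd' /= => cb db.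
case dc: (r d c).
  apply: (pick [:: false; true; true; true; false] b c d) => //.
  by rewrite cb dc orbT.
case ed: (r e d).
  apply: (pick [:: false; true; false; true; true] b d e) => //.
  by rewrite db ed orbT.
apply: (pick [:: false; false; true; true; true] c d e) => //.
by move: (r_total _ _ cd) (r_total _ _ de); rewrite dc ed !orbF => -> ->.
Qed.

Lemma contains_123_or_321 (w s : word) :
  subseq s w -> uniq s -> 5 <= size s ->
  contains w [:: 1; 2; 3] \/ contains w [:: 3; 2; 1].
Proof.
move=> sub_w uniq_s size_s.
have {sub_w}: subseq (take 5 s) w by apply: subseq_trans sub_w; apply: take_subseq.
move: (take_uniq 5 uniq_s).
case: s size_s {uniq_s} => [|a [|b [|c [|d [|e s]]]]] //= _.
rewrite take0 => uniq_s sub_w.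
have [ab|ba|ab] := ltngtP a b; last by move: uniq_s; rewrite ab /= inE eqxx.
- have [|x [y [z [sub_s mono]]]] := monotone_triple_of_step _ ltn _ _ _ _ _ _ uniq_s ab.
    by move=> x y; rewrite neq_ltn.
  have sub := subseq_trans sub_s sub_w.
  case/orP: mono => /andP[] /= xy yz; first by left; apply: contains_123 sub _ _.
  by right; apply: contains_321 sub _ _.
- have [|x [y [z [sub_s mono]]]] := monotone_triple_of_step _ gtn _ _ _ _ _ _ uniq_s ba.
    by move=> x y; rewrite neq_ltn orbC.
  have sub := subseq_trans sub_s sub_w.
  case/orP: mono => /andP[] /= xy yz; first by right; apply: contains_321 sub _ _.
  by left; apply: contains_123 sub _ _.
Qed.

(** Keeping one copy of each letter leaves a repetition-free subsequence whose
    letters are exactly [1, ..., n]. *)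
Lemma size_undup_double_multiset (n : nat) (w : word) :
  perm_eq w (double_multiset n) -> n <= size (undup w).
Proof.
move=> perm_w; rewrite -{1}(size_iota 1 n).
apply: uniq_leq_size (iota_uniq 1 n) _ => i i_n.
rewrite mem_undup (perm_mem perm_w); apply/flattenP; exists [:: i; i].
  exact: (map_f (fun i => [:: i; i])).
by rewrite inE eqxx.
Qed.

Theorem corollary2p4 (L : {fset word})
    (HL : L `<=` Sn 3)
    (H123_321 : [fset [:: 1; 2; 3]; [:: 3; 2; 1]] `<=` L)
    (n : nat) (Hn : 5 <= n) :
  cn n L = 0.
Proof.
apply/eqP; rewrite cardfs_eq0; apply/eqP/fsetP=> w; rewrite in_fset0.
apply/negbTE/negP; rewrite !inE mem_permutations /=.
case/andP=> /andP[perm_w _] /allP avoids_L.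
have avoids_pat p : p \in [fset [:: 1; 2; 3]; [:: 3; 2; 1]] -> ~ contains w p.
  by move=> /(fsubsetP H123_321) /avoids_L /negP.
have size_w := leq_trans Hn (size_undup_double_multiset _ _ perm_w).
have [|] := contains_123_or_321 _ _ (undup_subseq w) (undup_uniq w) size_w;
  by apply: avoids_pat; rewrite !inE eqxx ?orbT.
Qed.
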